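(* Let $\mathcal{H}$ be a separable Hilbert space, let $\{f_i\}_{i\in I}$ be a frame for $\mathcal{H}$ with frame operator $S$ and frame bounds $A\leqslant B$, and let $L:\mathcal{H}\to\mathcal{H}$ be a bounded linear operator. Then $\{Lf_i\}_{i\in I}$ is a frame for $\mathcal{H}$ if and only if $L$ is surjective. Moreover, in this case the frame operator for $\{Lf_i\}_{i\in I}$ is $LSL^*$, and $A\|L^{\dagger}\|^{-2}$ and $B\|L\|^2$ are (lower and upper, respectively) frame bounds for $\{Lf_i\}_{i\in I}$, where $L^{\dagger}$ is the pseudo-inverse of $L$.
   Context: The index set $I$ is countable. A sequence $\{f_i\}_{i\in I}\subseteq\mathcal{H}$ is a frame for $\mathcal{H}$ if there exist constants $0<A\leqslant B<\infty$ such that $A\|f\|^2\leqslant\sum_{i\in I}|\langle f,f_i\rangle|^2\leqslant B\|f\|^2$ for all $f\in\mathcal{H}$; such constants $A$ and $B$ are called a lower and an upper frame bound. The frame operator of a frame $\{f_i\}_{i\in I}$ is the bounded, positive, invertible operator $S:\mathcal{H}\to\mathcal{H}$, $Sf=\sum_{i\in I}\langle f,f_i\rangle f_i$. The pseudo-inverse $L^\dagger$ of a bounded operator $L$ with closed range is the (Moore–Penrose) bounded operator on $\mathcal{H}$ with $LL^\dagger f=f$ for $f$ in the range of $L$, kernel of $L^\dagger$ equal to the orthogonal complement of the range of $L$, and range of $L^\dagger$ equal to the orthogonal complement of the kernel of $L$. *)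

(* Defs.v *)
From HB Require Import structures.
From mathcomp Require Import all_boot all_order all_algebra finmap.
From mathcomp Require Import all_classical all_reals all_analysis.
From mathcomp Require Import complex.
From mathcomp.analysis.showcase Require summability.

Set Implicit Arguments.
Unset Strict Implicit.
Unset Printing Implicit Defensive.

Import Order.TTheory GRing.Theory Num.Theory.
Import numFieldNormedType.Exports.

Local Open Scope classical_set_scope.
Local Open Scope ring_scope.

(* Hilbert spaces are over the reals or over the complex numbers. *)
Variant scalar_kind := RealScalars | ComplexScalars.

Definition scalar_field (R : realType) (k : scalar_kind) : numFieldType :=
  match k with RealScalars => R | ComplexScalars => R[i] end.

Definition scalar_conj {R : realType} {k : scalar_kind} :
    scalar_field R k -> scalar_field R k :=
  match k with RealScalars => fun z => z | ComplexScalars => @conjc R end.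

Definition scalar_re {R : realType} {k : scalar_kind} : scalar_field R k -> R :=
  match k with RealScalars => fun z => z | ComplexScalars => @complex.Re R end.

Section ScalarConj.
Variables (R : realType) (k : scalar_kind).

Fact scalar_conj_is_zmod_morphism :
  zmod_morphism (@scalar_conj R k).
Proof. by case: k => // x y /=; exact: rmorphB. Qed.

Fact scalar_conj_is_monoid_morphism :
  monoid_morphism (@scalar_conj R k).
Proof.
case: k => //=; split; first exact: rmorph1.
by move=> x y /=; exact: rmorphM.
Qed.

HB.instance Definition _ :=
  GRing.isZmodMorphism.Build (scalar_field R k) (scalar_field R k)
    (@scalar_conj R k)
    scalar_conj_is_zmod_morphism.
HB.instance Definition _ :=
  GRing.isMonoidMorphism.Build (scalar_field R k) (scalar_field R k)
    (@scalar_conj R k)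
    scalar_conj_is_monoid_morphism.

End ScalarConj.

(* The inner product is linear in its first argument and conjugate-linear in
   the second one. *)
HB.mixin Record isHilbert (R : realType) (k : scalar_kind) (H : Type)
    of CompleteNormedModule (scalar_field R k) H := {
  inner : {dot H for @scalar_conj R k} ;
  innerxx : forall x : H, inner x x = `|x| ^+ 2
}.

#[short(type="hilbertType")]
HB.structure Definition Hilbert (R : realType) (k : scalar_kind) :=
  {H of CompleteNormedModule (scalar_field R k) H & isHilbert R k H}.

Definition separable (T : topologicalType) :=
  exists2 D : set T, countable D & dense D.

Section Operators.
Variables (R : realType) (k : scalar_kind) (H : hilbertType R k).
Implicit Types (L M : H -> H) (x y : H).

(* MathComp norms take their values in the scalar field; [scalar_re] brings
   them back to R. *)
Definition rnorm x : R := scalar_re `|x|.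

Definition bounded_op L := exists C : R, forall x, rnorm (L x) <= C * rnorm x.

(* The operator norm of a bounded operator ([sup] of an unbounded set is 0). *)
Definition opnorm L : R := sup [set rnorm (L x) | x in [set x | rnorm x <= 1]].

Definition ortho (V : set H) : set H :=
  [set x | forall y, V y -> inner x y = 0].

Definition ker L : set H := [set x | L x = 0].

(* For bounded linear [L], exactly one map [M] satisfies the condition. *)
Definition adjoint L : H -> H :=
  xget (fun=> 0) [set M : H -> H | forall x y, inner (L x) y = inner x (M y)].

Definition is_pseudo_inverse L M :=
  [/\ linear M, bounded_op M,
      forall y, range L y -> L (M y) = y,
      ker M = ortho (range L) &
      range M = ortho (ker L)].

(* For bounded linear [L] with closed range, exactly one map is a
   pseudo-inverse of [L]. *)
Definition pseudo_inverse L : H -> H :=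
  xget (fun=> 0) [set M : H -> H | is_pseudo_inverse L M].

End Operators.

Section Frames.
Variables (R : realType) (k : scalar_kind) (H : hilbertType R k).
Variable (I : countType).
Implicit Types (f : I -> H) (S : H -> H) (A B : R).

Definition frame_bounds f A B :=
  [/\ 0 < A, A <= B &
    forall x : H,
      ((A * rnorm x ^+ 2)%:E
         <= \esum_(i in [set: I]) (scalar_re `|inner x (f i)| ^+ 2)%:E)%E /\
      (\esum_(i in [set: I]) (scalar_re `|inner x (f i)| ^+ 2)%:E
         <= (B * rnorm x ^+ 2)%:E)%E].

Definition is_frame f := exists A B : R, frame_bounds f A B.

(* The series converges unconditionally: the limit is along the finite subsets
   of I, directed by inclusion. *)
Definition is_frame_operator f S :=
  forall x : H,
    summability.partial_sum (fun i => inner x (f i) *: f i)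
      @ summability.totally --> S x.

End Frames.

(* Main.v *)
(* Everything rests on the identity <x, L f_i> = <L^* x, f_i>: the frame sum of
   (L f_i) at x is the frame sum of (f_i) at L^* x, so (L f_i) is a frame iff
   L^* is bounded below.  If it is, L L^* is onto, hence so is L; if L is onto,
   L^* is bounded below by the uniform boundedness principle, and the constant
   |L^dagger| is read off from |y|^2 = <L L^dagger y, y> = <L^dagger y, L^* y>. *)
From HB Require Import structures.
Require Import Defs.
From mathcomp Require Import all_boot all_order all_algebra.
From mathcomp Require Import all_classical all_reals all_analysis.
From mathcomp Require Import complex ring lra.

Set Implicit Arguments.
Unset Strict Implicit.
Unset Printing Implicit Defensive.

Import Order.TTheory GRing.Theory Num.Theory.
Import numFieldNormedType.Exports.
Local Open Scope classical_set_scope.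
Local Open Scope ring_scope.

(** * Passage between the reals and the scalar field *)

Definition scalar_of_real {R : realType} {k : scalar_kind} :
    R -> scalar_field R k :=
  match k with RealScalars => id | ComplexScalars => fun t => (t%:C)%C end.

Section Scalars.
Variables (R : realType) (k : scalar_kind).
Implicit Types (z w : scalar_field R k) (s t : R).

Lemma scalar_reK t : scalar_re (scalar_of_real t : scalar_field R k) = t.
Proof. by case: k. Qed.

Lemma scalar_reD z w : scalar_re (z + w) = scalar_re z + scalar_re w.
Proof. by case: k z w => //= -[a b] [c d]. Qed.

Lemma scalar_reN z : scalar_re (- z) = - scalar_re z.
Proof. by case: k z => //= -[a b]. Qed.

Lemma scalar_reZ t z : scalar_re (scalar_of_real t * z) = t * scalar_re z.
Proof. by case: k z => //= -[a b]; rewrite /= mul0r subr0. Qed.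

Lemma scalar_re_conj z : scalar_re (scalar_conj z) = scalar_re z.
Proof. by case: k z => //= -[a b]. Qed.

Lemma scalar_norm_conj z : `|scalar_conj z| = `|z|.
Proof. by case: k z => //= z; rewrite normcJ. Qed.

(** The multiplier 1 recovers the real part and, over the complex numbers, ['i] recovers the
    imaginary part. Scalar identities can thus be proved through real parts alone. *)
Lemma scalar_eqP z w :
  (forall c, scalar_re (c * z) = scalar_re (c * w)) -> z = w.
Proof.
case: k z w => /= z w zw; first by have := zw 1; rewrite !mul1r.
move: z w zw => [a b] [c d] zw; have /= := zw 1.
have /= := zw 'i%C; rewrite !mul0r !mul1r !sub0r => /oppr_inj ->.
by rewrite !subr0 => ->.
Qed.

Lemma scalar_of_real_le s t :
  (scalar_of_real s <= scalar_of_real t :> scalar_field R k) = (s <= t).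
Proof. by case: k => //=; rewrite lecR. Qed.

Lemma scalar_of_real_lt s t :
  (scalar_of_real s < scalar_of_real t :> scalar_field R k) = (s < t).
Proof. by case: k => //=; rewrite ltcR. Qed.

Lemma scalar_of_real0 : scalar_of_real 0 = 0 :> scalar_field R k.
Proof. by case: k. Qed.

Lemma scalar_of_real1 : scalar_of_real 1 = 1 :> scalar_field R k.
Proof. by case: k. Qed.

Lemma scalar_of_realD s t : scalar_of_real (s + t) =
  scalar_of_real s + scalar_of_real t :> scalar_field R k.
Proof. by case: k => //=; rewrite rmorphD. Qed.

Lemma scalar_of_realM s t : scalar_of_real (s * t) =
  scalar_of_real s * scalar_of_real t :> scalar_field R k.
Proof. by case: k => //=; rewrite rmorphM. Qed.

Lemma scalar_of_realX t n :
  scalar_of_real (t ^+ n) = scalar_of_real t ^+ n :> scalar_field R k.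
Proof. by case: k => //=; rewrite rmorphXn. Qed.

Lemma scalar_norm_of_real t :
  `|scalar_of_real t| = scalar_of_real `|t| :> scalar_field R k.
Proof. by case: k => //=; rewrite normc_def /= expr0n addr0 sqrtr_sqr. Qed.

Lemma scalar_ge0E z : 0 <= z -> z = scalar_of_real (scalar_re z).
Proof. by case: k z => //= -[a b]; rewrite lecE /= => /andP[/eqP -> _]. Qed.

End Scalars.

(** * The real inner product space underlying [H] *)

Definition reinner {R : realType} {k : scalar_kind} {H : hilbertType R k}
  (x y : H) : R := scalar_re (inner x y).

Section RealForm.
Variables (R : realType) (k : scalar_kind) (H : hilbertType R k).
Implicit Types (x y z h : H) (t : R).

Lemma rnormE x : `|x| = scalar_of_real (rnorm x).
Proof. exact: scalar_ge0E. Qed.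

Lemma rnorm_ge0 x : 0 <= rnorm x.
Proof.
by rewrite -(@scalar_of_real_le _ k) -rnormE scalar_of_real0.
Qed.

Lemma rnorm0 : rnorm (0 : H) = 0.
Proof. by rewrite /rnorm normr0 -(scalar_of_real0 R k) scalar_reK. Qed.

Lemma rnorm_eq0 x : (rnorm x == 0) = (x == 0).
Proof.
rewrite -(normr_eq0 x) rnormE; apply/eqP/eqP => [->|/(congr1 scalar_re)].
  exact: scalar_of_real0.
by rewrite -(scalar_of_real0 R k) !scalar_reK.
Qed.

Lemma rnormN x : rnorm (- x) = rnorm x.
Proof. by rewrite /rnorm normrN. Qed.

Lemma rnorm_dist x y : rnorm (x - y) = rnorm (y - x).
Proof. by rewrite -rnormN opprB. Qed.

Lemma rnormD x y : rnorm (x + y) <= rnorm x + rnorm y.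
Proof.
rewrite -(@scalar_of_real_le _ k) -rnormE (le_trans (ler_normD _ _))//.
by rewrite !rnormE scalar_of_realD.
Qed.

Lemma rnormZ t x : rnorm (scalar_of_real t *: x) = `|t| * rnorm x.
Proof. by rewrite /rnorm normrZ scalar_norm_of_real scalar_reZ. Qed.

Lemma innerC x y : inner x y = scalar_conj (inner y x).
Proof. by rewrite [LHS]hermC expr0 mul1r. Qed.

Lemma reinnerC x y : reinner x y = reinner y x.
Proof. by rewrite /reinner innerC scalar_re_conj. Qed.

Lemma reinnerDl x y z : reinner (x + y) z = reinner x z + reinner y z.
Proof. by rewrite /reinner linearDl scalar_reD. Qed.

Lemma reinnerDr x y z : reinner z (x + y) = reinner z x + reinner z y.
Proof. by rewrite !(reinnerC z) reinnerDl. Qed.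

Lemma reinnerNl x y : reinner (- x) y = - reinner x y.
Proof. by rewrite /reinner linearNl scalar_reN. Qed.

Lemma reinnerNr x y : reinner y (- x) = - reinner y x.
Proof. by rewrite !(reinnerC y) reinnerNl. Qed.

Lemma reinnerZl t x y : reinner (scalar_of_real t *: x) y = t * reinner x y.
Proof. by rewrite /reinner linearZl_LR /= scalar_reZ. Qed.

Lemma reinnerZr t x y : reinner y (scalar_of_real t *: x) = t * reinner y x.
Proof. by rewrite !(reinnerC y) reinnerZl. Qed.

Lemma reinnerxx x : reinner x x = rnorm x ^+ 2.
Proof. by rewrite /reinner innerxx rnormE -scalar_of_realX scalar_reK. Qed.

Lemma rnormDZ_sqr t x h : rnorm (x + scalar_of_real t *: h) ^+ 2 =
  rnorm x ^+ 2 + 2 * t * reinner h x + t ^+ 2 * rnorm h ^+ 2.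
Proof.
rewrite -!reinnerxx !(reinnerDl, reinnerDr, reinnerZl, reinnerZr).
rewrite (reinnerC x h); ring.
Qed.

Lemma reinner_le x y : reinner x y <= rnorm x * rnorm y.
Proof.
have [->|y0] := eqVneq y 0.
  by rewrite -(scale0r 0) -scalar_of_real0 reinnerZr mul0r mulr_ge0 ?rnorm_ge0.
have ny : 0 < rnorm y by rewrite lt_neqAle eq_sym rnorm_eq0 y0 rnorm_ge0.
have [->|x0] := eqVneq x 0.
  by rewrite -(scale0r 0) -scalar_of_real0 reinnerZl mul0r mulr_ge0 ?rnorm_ge0.
have nx : 0 < rnorm x by rewrite lt_neqAle eq_sym rnorm_eq0 x0 rnorm_ge0.
(* Cauchy-Schwarz: the squared norm of |y| x - |x| y expands to 2|x||y| (|x||y| - Re <x, y>). *)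
have := sqr_ge0 (rnorm (scalar_of_real (rnorm y) *: x +
                        scalar_of_real (- rnorm x) *: y)).
rewrite rnormDZ_sqr rnormZ reinnerZr (reinnerC y) ger0_norm ?rnorm_ge0//.
set a := rnorm x in nx *; set b := rnorm y in ny *; set r := reinner _ _.
rewrite (_ : _ + _ = 2 * (a * b) * (a * b - r)); last by ring.
by rewrite pmulr_rge0 ?mulr_gt0// subr_ge0.
Qed.

Lemma reinner_abs_le x y : `|reinner x y| <= rnorm x * rnorm y.
Proof.
by rewrite ler_norml reinner_le andbT lerNl -reinnerNl -(rnormN x) reinner_le.
Qed.

Lemma inner_eqP x y : (forall h, inner h x = inner h y) -> x = y.
Proof.
move=> hxy; apply/eqP; rewrite -subr_eq0 -rnorm_eq0 -sqrf_eq0 -reinnerxx.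
by rewrite reinnerDr reinnerNr /reinner hxy subrr.
Qed.

(** Radii of balls live in the scalar field, but a positive scalar is the image of its real part, so
    real radii suffice. *)
Lemma rnorm_complete (u : nat -> H) :
  (forall e : R, 0 < e ->
     exists N, forall m n, (N <= m)%N -> (N <= n)%N -> rnorm (u m - u n) < e) ->
  exists l, forall e : R, 0 < e ->
    exists N, forall n, (N <= n)%N -> rnorm (u n - l) < e.
Proof.
move=> uC.
have /cauchy_cvg/cvg_ex[l ul] : cauchy (u @ \oo).
  apply/cauchy_exP => e e0.
  have e0' : 0 < scalar_re e.
    by rewrite -(@scalar_of_real_lt _ k) -scalar_ge0E ?ltW// scalar_of_real0.
  have [N uN] := uC _ e0'; exists (u N).
  exists N => // n /= Nn; rewrite -ball_normE /= rnormE (scalar_ge0E (ltW e0)).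
  by rewrite scalar_of_real_lt uN.
exists l => e e0.
have /cvgrPdist_lt/(_ (scalar_of_real e)) := ul.
rewrite -(scalar_of_real0 R k) scalar_of_real_lt => /(_ e0)[N _ uN].
exists N => n Nn; rewrite rnorm_dist.
by have := uN n Nn; rewrite /= rnormE scalar_of_real_lt.
Qed.

End RealForm.

(** * Bounded operators: a variational problem, adjoints and lower bounds *)

Section Operators.
Variables (R : realType) (k : scalar_kind) (H : hilbertType R k).
Implicit Types (x y z h : H) (t : R) (L M G : {linear H -> H}).

Lemma bounded_op_gt0 (T : H -> H) : bounded_op T ->
  exists2 C : R, 0 < C & forall x, rnorm (T x) <= C * rnorm x.
Proof.
move=> [C TC]; exists (Num.max C 1); first by rewrite lt_max ltr01 orbT.
move=> x; rewrite (le_trans (TC x))// ler_wpM2r ?rnorm_ge0//.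
by rewrite le_max lexx.
Qed.

Lemma invS_lt (e : R) : 0 < e ->
  exists N, forall n, (N <= n)%N -> n.+1%:R^-1 < e.
Proof.
move=> e0; have [N _ Ne] := near_infty_natSinv_lt (PosNum e0).
by exists N => n /Ne.
Qed.

(* The solution minimises [|G x|^2 - 2 Re <M x, y>]: minimising sequences are
   Cauchy by the parallelogram identity. *)
Lemma variational_solution G M (c : R) y :
  bounded_op G -> bounded_op M ->
  (forall x, rnorm x <= c * rnorm (G x)) ->
  exists x, forall h, inner (G h) (G x) = inner (M h) y.
Proof.
move=> /bounded_op_gt0[C C0 GC] /bounded_op_gt0[D D0 MD] Gc0.
have [c' c'0 Gc] : exists2 c', 0 < c' & forall x, rnorm x <= c' * rnorm (G x).
  exists (Num.max c 1); first by rewrite lt_max ltr01 orbT.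
  move=> x; rewrite (le_trans (Gc0 x))// ler_wpM2r ?rnorm_ge0//.
  by rewrite le_max lexx.
pose phi h := reinner (M h) y.
pose J x := rnorm (G x) ^+ 2 - 2 * phi x.
have JDZ x h t : J (x + scalar_of_real t *: h) = J x +
    2 * t * (reinner (G h) (G x) - phi h) + t ^+ 2 * rnorm (G h) ^+ 2.
  have TDZ (T : {linear H -> H}) a : T (x + a *: h) = T x + a *: T h.
    by rewrite linearD linearZ.
  rewrite /J /phi !TDZ rnormDZ_sqr reinnerDl reinnerZl; ring.
have Jlb : has_inf (range J).
  split; first by exists (J 0), 0.
  (* With K = D c' |y| and s = |G x|, [J x] is at least s^2 - 2 K s, hence at least -K^2. *)
  exists (- (D * c' * rnorm y) ^+ 2) => _ [x _ <-].
  have px : phi x <= D * c' * rnorm y * rnorm (G x).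
    rewrite (le_trans (reinner_le _ _))// mulrAC ler_wpM2r ?rnorm_ge0//.
    by rewrite (le_trans (MD x))// -mulrA ler_wpM2l// ltW.
  rewrite /J; have := sqr_ge0 (rnorm (G x) - D * c' * rnorm y); lra.
pose m := inf (range J).
have mJ x : m <= J x by apply: ge_inf; [case: Jlb|exists x].
have /choice[u uJ] n : exists x, J x < m + n.+1%:R^-1.
  have n0 : 0 < n.+1%:R^-1 :> R by rewrite invr_gt0.
  by have [_ [x _ <-] ?] := inf_adherent n0 Jlb; exists x.
have uC a b : rnorm (u a - u b) ^+ 2 <=
    c' ^+ 2 * (2 * a.+1%:R^-1 + 2 * b.+1%:R^-1).
  (* Steps 1 and 1/2 from [u b] reach [u a] and the midpoint. Eliminating the linear term gives |G
     (u a - u b)|^2 = 2 J(u a) + 2 J(u b) - 4 J(midpoint), where J(midpoint) is at least [m]. *)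
  have h1 := JDZ (u b) (u a - u b) 1.
  have h2 := JDZ (u b) (u a - u b) 2^-1.
  rewrite scalar_of_real1 scale1r addrC subrK in h1.
  have h3 := mJ (u b + scalar_of_real 2^-1 *: (u a - u b)).
  have Ja := uJ a; have Jb := uJ b.
  apply: (@le_trans _ _ (c' ^+ 2 * rnorm (G (u a - u b)) ^+ 2)).
    by rewrite -exprMn lerXn2r ?nnegrE ?rnorm_ge0// mulr_ge0 ?rnorm_ge0// ltW.
  rewrite ler_wpM2l ?sqr_ge0//.
  move: (a.+1%:R^-1) (b.+1%:R^-1) Ja Jb => ra rb Ja Jb; lra.
have [x ux] : exists l, forall e : R, 0 < e ->
    exists N, forall n, (N <= n)%N -> rnorm (u n - l) < e.
  apply: rnorm_complete => e e0.
  (* Chosen so that c'^2 (2 q + 2 q) = e^2 for this value q. *)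
  have q0 : 0 < (e / c') ^+ 2 / 4 by rewrite divr_gt0// exprn_gt0// divr_gt0.
  have [N Nq] := invS_lt q0; exists N => a b Na Nb.
  rewrite -(@ltr_pXn2r _ 2) ?nnegrE ?rnorm_ge0 ?(ltW e0)//.
  rewrite (le_lt_trans (uC a b))//.
  rewrite (_ : e ^+ 2 = c' ^+ 2 * (4 * ((e / c') ^+ 2 / 4))); last first.
    by field; rewrite gt_eqF.
  rewrite ltr_pM2l ?exprn_gt0//; have := Nq _ Na; have := Nq _ Nb.
  by move: (a.+1%:R^-1) (b.+1%:R^-1) (_ / 4) => ra rb q; lra.
exists x.
(* Replacing [h] by its scalar multiples turns the real identity into the full one. *)
suff reE h : reinner (G h) (G x) = phi h.
  move=> h; apply: scalar_eqP => a.
  by have := reE (a *: h); rewrite /phi /reinner !linearZ /= !linearZl_LR.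
(* If the defect [d] at [x] were nonzero, a large n would put [dn n] within |d|/2 of both 0
   (near-minimality of [u n]) and [d] (convergence of [u] to [x]). *)
apply/eqP; rewrite -subr_eq0 -normr_eq0; apply/negPn/negP => dn0.
set d := _ - _ in dn0.
have d0 : 0 < `|d| / 2 by rewrite divr_gt0// lt_neqAle eq_sym dn0 normr_ge0.
pose a := rnorm (G h) ^+ 2.
have a0 : 0 <= a by exact: sqr_ge0.
pose dn n := reinner (G h) (G (u n)) - phi h.
(* minimality of [m] against a step of length [- dn n / (a + 1)] along [h] *)
have dn_le n : dn n ^+ 2 <= (a + 1) / n.+1%:R.
  have h1 := mJ (u n + scalar_of_real (- dn n / (a + 1)) *: h).
  rewrite JDZ -/(dn n) -/a in h1; have h2 := uJ n.
  rewrite mulrC -ler_pdivrMr ?ltr_pwDr//.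
  have : (- dn n / (a + 1)) ^+ 2 * a <= dn n ^+ 2 / (a + 1).
    rewrite (_ : (- dn n / (a + 1)) ^+ 2 * a =
      dn n ^+ 2 / (a + 1) * (a / (a + 1))); last first.
      by field; rewrite gt_eqF// ltr_pwDr.
    rewrite ler_piMr ?divr_ge0 ?sqr_ge0 ?addr_ge0//.
    by rewrite ler_pdivrMr ?ltr_pwDr// mul1r lerDl.
  rewrite (_ : 2 * (- dn n / (a + 1)) * dn n =
    - 2 * (dn n ^+ 2 / (a + 1))) in h1; last first.
    by field; rewrite gt_eqF// ltr_pwDr.
  move: (n.+1%:R^-1) (dn n ^+ 2 / (a + 1)) (_ ^+ 2 * a) h1 h2 => r p q; lra.
have K0 : 0 < C * rnorm (G h) + 1.
  by rewrite ltr_pwDr// mulr_ge0 ?rnorm_ge0// ltW.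
have [N1 N1P] := ux _ (divr_gt0 d0 K0).
have [N2 N2P] := invS_lt (divr_gt0 (exprn_gt0 2 d0) (ltr_pwDr ltr01 a0)).
have {N1P} := N1P _ (leq_maxl N1 N2); have {N2P} := N2P _ (leq_maxr N1 N2).
set n := maxn N1 N2.
rewrite (ltr_pdivlMr _ _ K0) (ltr_pdivlMr _ _ (ltr_pwDr ltr01 a0)) => e1 e2.
have : `|dn n| < `|d| / 2.
  rewrite -(@ltr_pXn2r _ 2) ?nnegrE ?normr_ge0 ?(ltW d0)//.
  by rewrite real_normK ?num_real// (le_lt_trans (dn_le n))// mulrC.
have : `|dn n - d| < `|d| / 2.
  rewrite /dn /d opprB addrA subrK -reinnerNr -reinnerDr -linearB.
  rewrite (le_lt_trans (reinner_abs_le _ _))// (le_lt_trans _ e2)//.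
  have := GC (u n - x); have := rnorm_ge0 (G h).
  have := rnorm_ge0 (u n - x); nra.
have := ler_normB (dn n) (dn n - d); rewrite opprB addrC subrK; lra.
Qed.

Lemma bounded_op_continuous L : bounded_op L -> continuous L.
Proof.
move=> /bounded_op_gt0[C C0 LC]; apply/linear_bounded_continuous/bounded_funP.
move=> r; exists (scalar_of_real C * r) => x xr.
apply: (@le_trans _ _ (scalar_of_real C * `|x|)).
  by rewrite !rnormE -scalar_of_realM scalar_of_real_le.
by rewrite ler_wpM2l// -(scalar_of_real0 R k) scalar_of_real_le ltW.
Qed.

(** Riesz representation: the variational problem with the identity for [G] and [L] for [M] yields a
    value of the adjoint at each point, so [xget] does not fall back on its default. *)
Lemma adjointP L x y : bounded_op L -> inner (L x) y = inner x (adjoint L y).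
Proof.
move=> bL; suff : [set M : H -> H | forall x y, inner (L x) y = inner x (M y)]
    (adjoint L) by move=> adjL; exact: adjL.
apply: xgetPex.
have /choice[M MP] y' : exists x, forall h, inner h x = inner (L h) y'.
  apply: (@variational_solution idfun L 1) => //.
    by exists 1 => z; rewrite mul1r.
  by move=> z; rewrite mul1r.
by exists M => u v; rewrite MP.
Qed.

Lemma adjoint_linear L : bounded_op L -> linear (adjoint L).
Proof.
move=> bL a u v; apply: inner_eqP => h.
rewrite -adjointP// [LHS]linearDr [RHS]linearDr !linearZr_LR.
by congr (_ + _); last exact: adjointP; congr (_ * _); exact: adjointP.
Qed.

Lemma reinner_adjoint L x y : bounded_op L ->
  reinner (L x) y = reinner x (adjoint L y).
Proof. by move=> bL; rewrite /reinner adjointP. Qed.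

(** Divide |L^* y|^2 = Re <L L^* y, y>, which is at most C |L^* y| |y|, by |L^* y|. *)
Lemma rnorm_adjoint_le L (C : R) y : bounded_op L ->
  (forall x, rnorm (L x) <= C * rnorm x) ->
  rnorm (adjoint L y) <= C * rnorm y.
Proof.
move=> bL LC; have [->|n0] := eqVneq (rnorm (adjoint L y)) 0.
  exact: le_trans (rnorm_ge0 (L y)) (LC y).
have nP : 0 < rnorm (adjoint L y) by rewrite lt_neqAle eq_sym n0 rnorm_ge0.
rewrite -(ler_pM2l nP) -expr2 -reinnerxx -reinner_adjoint//.
rewrite (le_trans (reinner_le _ _))// mulrA [rnorm (adjoint L y) * C]mulrC.
by rewrite ler_wpM2r ?rnorm_ge0.
Qed.

Lemma adjoint_bounded L : bounded_op L -> bounded_op (adjoint L).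
Proof.
by move=> bL; have [C LC] := bL; exists C => y; apply: rnorm_adjoint_le.
Qed.

(* Gliding hump: if [y n] are unit vectors with [L^* (y n)] tending to 0 faster
   than [3^-n], a series of the vectors [+- 3^-n *: y n] sums to a point outside
   the range of [L]. *)
Lemma surjective_adjoint_bounded_below L : bounded_op L ->
  (forall y, exists x, L x = y) ->
  exists2 c : R, 0 < c & forall y, rnorm y <= c * rnorm (adjoint L y).
Proof.
move=> bL Lsurj; apply: contrapT => noc.
pose p n : R := 3^-1 ^+ n.
have p0 n : 0 < p n by rewrite exprn_gt0.
have pS n : p n.+1 = p n / 3 by rewrite /p exprS mulrC.
(* Normalise a vector that violates the lower bound for the constant (n+1) / p n. *)
have /choice[y yP] n : exists y,
    rnorm y = 1 /\ rnorm (adjoint L y) < p n / n.+1%:R.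
  have c0 : 0 < n.+1%:R / p n by rewrite divr_gt0.
  apply: contrapT => noy; apply: noc; exists (n.+1%:R / p n) => // y.
  rewrite leNgt; apply/negP => yc; apply: noy.
  have y0 : 0 < rnorm y.
    by rewrite (le_lt_trans _ yc)// mulr_ge0 ?rnorm_ge0 ?ltW.
  exists (scalar_of_real (rnorm y)^-1 *: y).
  have -> : adjoint L (scalar_of_real (rnorm y)^-1 *: y) =
      scalar_of_real (rnorm y)^-1 *: adjoint L y.
    have aL := adjoint_linear bL.
    have L0 : adjoint L 0 = 0.
      apply/(addrI (adjoint L 0)).
      by rewrite addr0 -[X in X + _]scale1r -aL scale1r addr0.
    by rewrite -[X in adjoint L X]addr0 aL L0 addr0.
  rewrite !rnormZ gtr0_norm ?invr_gt0// mulVf ?gt_eqF//; split => //.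
  rewrite mulrC ltr_pdivrMr// -ltr_pdivrMl ?divr_gt0// invf_div.
  exact: yc.
(* The sign follows that of Re <x, y n>, so the new term cannot cancel against the earlier ones. *)
pose t n x : R := if 0 <= reinner x (y n) then p n else - p n.
pose u := fix u n : H :=
  if n is n'.+1 then u n' + scalar_of_real (t n' (u n')) *: y n' else 0.
have uS n : u n.+1 = u n + scalar_of_real (t n (u n)) *: y n by [].
have tn n x : `|t n x| = p n.
  by rewrite /t; case: ifP => _; rewrite ?normrN gtr0_norm.
have uy n : p n <= `|reinner (u n.+1) (y n)|.
  rewrite uS reinnerDl reinnerZl reinnerxx (yP n).1 expr1n mulr1 /t.
  have pn := p0 n; case: ifPn => [r0|].
    by rewrite ger0_norm ?addr_ge0 ?(ltW pn)// lerDr.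
  rewrite -ltNge => r0; rewrite ltr0_norm; lra.
(* The right-hand side is the geometric sum of [p i] for i from n to n + m - 1. *)
have u_dist n m : rnorm (u (n + m)%N - u n) <= 3 / 2 * (p n - p (n + m)%N).
  elim: m => [|m IH]; first by rewrite addn0 !subrr rnorm0 mulr0.
  rewrite addnS uS addrAC (le_trans (rnormD _ _))// rnormZ tn (yP _).1 pS; lra.
have u_le n m : rnorm (u (n + m)%N - u n) <= 3 / 2 * p n.
  have := u_dist n m; have := p0 (n + m)%N; lra.
have [x ux] : exists l, forall e : R, 0 < e ->
    exists N, forall n, (N <= n)%N -> rnorm (u n - l) < e.
  apply: rnorm_complete => e e0.
  have pcv : p @ \oo --> (0 : R).
    by apply: cvg_expr; rewrite ger0_norm// invf_lt1// ltr1n.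
  have e6 : 0 < e / 6 by rewrite divr_gt0.
  have /cvgrPdist_lt/(_ _ e6)[N _ Np] := pcv.
  exists N => m n /subnKC <- /subnKC <-.
  have := Np N (leqnn N); rewrite /= sub0r normrN gtr0_norm// => pN.
  rewrite -(subrKA (u N)) (le_lt_trans (rnormD _ _))// (rnorm_dist (u N)).
  have := u_le N (m - N)%N; have := u_le N (n - N)%N; lra.
have ux_le n : rnorm (u n - x) <= 3 / 2 * p n.
  apply/ler_addgt0Pr => e e0; have [N NP] := ux _ e0.
  have := NP (n + N)%N (leq_addl _ _); have := u_le n N.
  rewrite rnorm_dist => h1 h2.
  rewrite -(subrKA (u (n + N)%N)) (le_trans (rnormD _ _))//; lra.
have [z zx] := Lsurj x.
(* This makes |z| / (N+1) smaller than 1/2; the added 1 covers z = 0. *)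
have [N NP] : exists N, forall n, (N <= n)%N ->
    n.+1%:R^-1 < (2 * (rnorm z + 1))^-1.
  by apply: invS_lt; rewrite invr_gt0 mulr_gt0// ltr_pwDr ?rnorm_ge0.
(* The terms after the N-th contribute at most 3/2 p(N+1) = p N / 2, so half of the hump survives in
   the limit. *)
have xy : p N / 2 <= `|reinner x (y N)|.
  have h1 := uy N; have h2 := ux_le N.+1; rewrite pS in h2.
  have h3 := reinner_abs_le (u N.+1 - x) (y N).
  rewrite (yP N).1 mulr1 in h3.
  have := ler_normD (reinner (u N.+1 - x) (y N)) (reinner x (y N)).
  rewrite -reinnerDl subrK; lra.
have : `|reinner x (y N)| <= rnorm z * (p N / N.+1%:R).
  rewrite -zx reinner_adjoint// (le_trans (reinner_abs_le _ _))//.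
  by rewrite ler_wpM2l ?rnorm_ge0// ltW// (yP N).2.
apply/negP; rewrite -ltNge (lt_le_trans _ xy)// mulrCA ltr_pM2l//.
have z1 : 0 < rnorm z + 1 by rewrite ltr_pwDr ?rnorm_ge0.
rewrite (@le_lt_trans _ _ ((rnorm z + 1) / N.+1%:R))//.
  by rewrite ler_wpM2r ?lerDl.
by rewrite -ltr_pdivlMl// -invfM mulrC NP.
Qed.

(** * The pseudo-inverse of a surjective operator, and the operator norm *)

Definition linear_map (T : H -> H) (lT : linear T) : {linear H -> H} :=
  HB.pack T (GRing.isLinear.Build _ _ _ _ _ lT).

(** The variational problem with L^* for [G] and the identity for [M] gives <L^* h, L^* x> = <h, y>
    for all h, the weak form of L L^* x = y. *)
Lemma comp_adjoint_surjective L (c : R) y : bounded_op L ->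
  (forall z, rnorm z <= c * rnorm (adjoint L z)) ->
  exists x, L (adjoint L x) = y.
Proof.
move=> bL Lc; have [|||x xP] :=
    @variational_solution (linear_map (adjoint_linear bL)) idfun c y.
- exact: adjoint_bounded.
- by exists 1 => z; rewrite mul1r.
- exact: Lc.
exists x; apply: inner_eqP => h; rewrite innerC adjointP// -innerC.
exact: xP.
Qed.

(** Pairing L L^* x with x gives |L^* x|^2. *)
Lemma comp_adjoint_eq0 L x : bounded_op L ->
  L (adjoint L x) = 0 -> adjoint L x = 0.
Proof.
move=> bL LLx0; apply/eqP; rewrite -rnorm_eq0 -sqrf_eq0 -reinnerxx.
rewrite -reinner_adjoint// LLx0 /reinner linear0l.
by rewrite -(scalar_of_real0 R k) scalar_reK.
Qed.

(* For surjective [L] the pseudo-inverse is [L^* (L L^* )^-1]. *)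
Lemma pseudo_inverseP L : bounded_op L -> (forall y, exists x, L x = y) ->
  is_pseudo_inverse L (pseudo_inverse L).
Proof.
move=> bL Lsurj.
suff : [set M | is_pseudo_inverse L M] (pseudo_inverse L) by [].
apply: xgetPex.
have [c c0 Lc] := surjective_adjoint_bounded_below bL Lsurj.
have /choice[K KP] y := comp_adjoint_surjective y bL Lc.
pose A := linear_map (adjoint_linear bL).
have AE x : adjoint L x = A x by [].
have A_ker x z : L z = 0 -> inner (A x) z = 0.
  by move=> z0; rewrite innerC -AE -adjointP// z0 linear0l rmorph0.
have inj0 x : L (A x) = 0 -> A x = 0 by exact: comp_adjoint_eq0.
exists (A \o K); split.
(* [K] is only a choice of preimages. The linearity defect of [A \o K] lies in the range of [A] and
   is killed by [L], so it vanishes by [inj0]. *)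
- move=> a u v; apply/eqP; rewrite -subr_eq0 /=; apply/eqP.
  have <- : A (K (a *: u + v) - (a *: K u + K v)) =
      A (K (a *: u + v)) - (a *: A (K u) + A (K v)) by rewrite linearB linearP.
  by apply: inj0; rewrite linearB linearP linearB linearP !KP subrr.
(* |A K y|^2 = Re <y, K y> is at most |y| c |A K y|. *)
- exists c => y /=; have [->|n0] := eqVneq (rnorm (A (K y))) 0.
    by rewrite mulr_ge0 ?rnorm_ge0 ?ltW.
  have nP : 0 < rnorm (A (K y)) by rewrite lt_neqAle eq_sym n0 rnorm_ge0.
  rewrite -(ler_pM2l nP) -expr2 -reinnerxx -{2}AE -reinner_adjoint// -AE KP.
  rewrite (le_trans (reinner_le _ _))// mulrC mulrA ler_wpM2r ?rnorm_ge0//.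
  by rewrite mulrC Lc.
- by move=> y _; exact: KP.
- apply/seteqP; split => x /=.
    by rewrite /ker /= => AKx0 y _; rewrite -(KP x) AKx0 linear0 linear0l.
  move=> xo; apply: inj0; rewrite -AE KP; apply/eqP.
  have [w wx] := Lsurj x; rewrite -rnorm_eq0 -sqrf_eq0 -reinnerxx /reinner.
  by rewrite xo -?(scalar_of_real0 R k) ?scalar_reK//; exists w.
- apply/seteqP; split => x /=.
    by move=> [y _ <-] z z0; exact: A_ker.
  move=> xo; exists (L x) => //; apply/eqP; rewrite eq_sym -subr_eq0.
  (* [d] lies in the kernel of [L], and both of its terms are orthogonal to that kernel. *)
  set d := x - _; have Ld : L d = 0 by rewrite /d linearB KP subrr.
  rewrite -rnorm_eq0 -sqrf_eq0 -reinnerxx {1}/d reinnerDl reinnerNl.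
  by rewrite /reinner xo// A_ker// subrr.
Qed.

Lemma rnorm_le_opnorm (T : H -> H) x : linear T -> bounded_op T ->
  rnorm (T x) <= opnorm T * rnorm x.
Proof.
move=> lT /bounded_op_gt0[C C0 TC].
have T0 : T 0 = 0 by exact: (linear0 (linear_map lT)).
have TZ a y : T (a *: y) = a *: T y by rewrite -[a *: y]addr0 lT T0 addr0.
have [->|x0] := eqVneq x 0; first by rewrite T0 rnorm0 mulr0.
have nx : 0 < rnorm x by rewrite lt_neqAle eq_sym rnorm_eq0 x0 rnorm_ge0.
rewrite -ler_pdivrMr// mulrC.
have -> : (rnorm x)^-1 * rnorm (T x) =
    rnorm (T (scalar_of_real (rnorm x)^-1 *: x)).
  by rewrite TZ rnormZ gtr0_norm ?invr_gt0.
apply: ub_le_sup.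
  exists C => _ [z /= z1 <-]; rewrite (le_trans (TC z))//.
  by rewrite ler_piMr// ltW.
exists (scalar_of_real (rnorm x)^-1 *: x) => //=.
by rewrite rnormZ gtr0_norm ?invr_gt0// mulVf ?gt_eqF.
Qed.

End Operators.

(** * Images of frames under a bounded operator *)

Section Frames.
Variables (R : realType) (k : scalar_kind) (H : hilbertType R k).
Variables (I : countType) (f : I -> H) (A B : R) (L : {linear H -> H}).
Hypotheses (fAB : frame_bounds f A B) (bL : bounded_op L).

Lemma esum_image_frame x :
  \esum_(i in [set: I]) (scalar_re `|inner x ((L \o f) i)| ^+ 2)%:E =
  \esum_(i in [set: I]) (scalar_re `|inner (adjoint L x) (f i)| ^+ 2)%:E.
Proof.
apply: eq_esum => i _ /=.
by rewrite innerC scalar_norm_conj adjointP// innerC scalar_norm_conj.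
Qed.

(** The constants stay free to serve twice: with some constants for the frame property, and with the
    norms of L^dagger and L for the explicit bounds. *)
Lemma image_frame_le (c C : R) x : 0 < c ->
  (forall y, rnorm y <= c * rnorm (adjoint L y)) ->
  (forall y, rnorm (L y) <= C * rnorm y) ->
  ((A * c ^- 2 * rnorm x ^+ 2)%:E
     <= \esum_(i in [set: I]) (scalar_re `|inner x ((L \o f) i)| ^+ 2)%:E)%E /\
  (\esum_(i in [set: I]) (scalar_re `|inner x ((L \o f) i)| ^+ 2)%:E
     <= (B * C ^+ 2 * rnorm x ^+ 2)%:E)%E.
Proof.
case: fAB => A0 AB fS c0 Lc LC; have B0 : 0 < B by rewrite (lt_le_trans A0).
have [lo up] := fS (adjoint L x); rewrite esum_image_frame; split.
  apply: le_trans lo; rewrite lee_fin -mulrA ler_wpM2l ?(ltW A0)//.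
  rewrite ler_pdivrMl ?exprn_gt0// -exprMn.
  by rewrite lerXn2r ?nnegrE ?mulr_ge0 ?rnorm_ge0 ?(ltW c0).
apply: (le_trans up); rewrite lee_fin -mulrA ler_wpM2l ?(ltW B0)// -exprMn.
have LCx := rnorm_adjoint_le x bL LC.
by rewrite lerXn2r ?nnegrE ?(le_trans _ LCx) ?rnorm_ge0.
Qed.

Lemma image_frame_surjective : is_frame (L \o f) -> forall y, exists x, L x = y.
Proof.
move=> [A' [B' [A'0 _ LfS]]] y; case: fAB => A0 AB fS.
have B0 : 0 < B by rewrite (lt_le_trans A0).
(* The two frame inequalities chain to A' |z|^2 <= B |L^* z|^2. *)
have [//|x Lx] := @comp_adjoint_surjective R k H L (Num.sqrt (B / A')) y bL.
  move=> z; rewrite -(@ler_pXn2r _ 2) ?nnegrE ?rnorm_ge0//; last first.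
    by rewrite mulr_ge0 ?sqrtr_ge0 ?rnorm_ge0.
  rewrite exprMn sqr_sqrtr; last by rewrite divr_ge0 ?ltW.
  rewrite mulrAC ler_pdivlMr// mulrC.
  have [lo _] := LfS z; have [_ up] := fS (adjoint L z).
  rewrite esum_image_frame in lo.
  by rewrite -lee_fin (le_trans lo up).
by exists (adjoint L x).
Qed.

Lemma surjective_image_frame :
  (forall y, exists x, L x = y) -> is_frame (L \o f).
Proof.
move=> Lsurj.
have [c c0 Lc] := surjective_adjoint_bounded_below bL Lsurj.
have [C C0 LC] := bounded_op_gt0 bL.
have A0 : 0 < A by case: fAB.
(* The maximum orders the two bounds even in the zero space, where the frame inequalities say
   nothing about the constants. *)
exists (A * c ^- 2), (Num.max (A * c ^- 2) (B * C ^+ 2)); split.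
- by rewrite divr_gt0// exprn_gt0.
- by rewrite le_max lexx.
move=> x; have [lo up] := image_frame_le x c0 Lc LC; split => //.
apply: (le_trans up); rewrite lee_fin ler_wpM2r ?sqr_ge0//.
by rewrite le_max lexx orbT.
Qed.

(** The partial sums at x are [L] applied to those of [f] at L^* x, and continuity of [L] passes to
    the limit. *)
Lemma image_frame_operator S : is_frame_operator f S ->
  is_frame_operator (L \o f) (L \o S \o adjoint L).
Proof.
move=> fS x /=.
have -> : summability.partial_sum (fun i => inner x (L (f i)) *: L (f i)) =
    L \o summability.partial_sum (fun i => inner (adjoint L x) (f i) *: f i).
  apply/funext => J /=; rewrite /summability.partial_sum linear_sum.
  apply: eq_bigr => i _; rewrite linearZ; congr (_ *: _).
  by rewrite innerC adjointP// -innerC.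
apply: (cvg_comp _ _ (fS (adjoint L x))).
exact: bounded_op_continuous.
Qed.

Lemma image_frame_bounds : (exists x : H, x != 0) ->
  (forall y, exists x, L x = y) ->
  frame_bounds (L \o f) (A * opnorm (pseudo_inverse L) ^- 2)
    (B * opnorm L ^+ 2).
Proof.
move=> [x0 x0n0] Lsurj.
have [lM bM LM _ _] := pseudo_inverseP bL Lsurj.
set M := pseudo_inverse L in lM bM LM *.
have LMK y : L (M y) = y by apply: LM; have [w <-] := Lsurj y; exists w.
have MN y : rnorm (M y) <= opnorm M * rnorm y by exact: rnorm_le_opnorm.
have LN y : rnorm (L y) <= opnorm L * rnorm y.
  by apply: rnorm_le_opnorm => // a u v; rewrite linearP.
have nx : 0 < rnorm x0 by rewrite lt_neqAle eq_sym rnorm_eq0 x0n0 rnorm_ge0.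
(* In the zero space this norm is 0 and the lower bound degenerates to 0, since 0 is its own inverse
   here; [x0] excludes that case, [M] being injective. *)
have M0 : 0 < opnorm M.
  have Mx : 0 < rnorm (M x0).
    rewrite lt_neqAle eq_sym rnorm_eq0 rnorm_ge0 andbT.
    by apply: contra x0n0 => /eqP Mx0; rewrite -(LMK x0) Mx0 linear0.
  by rewrite -(pmulr_lgt0 _ nx) (lt_le_trans Mx).
have Ly y : rnorm y <= opnorm M * rnorm (adjoint L y).
  have [->|y0] := eqVneq y 0.
    by rewrite rnorm0 mulr_ge0 ?rnorm_ge0 ?(ltW M0).
  have ny : 0 < rnorm y by rewrite lt_neqAle eq_sym rnorm_eq0 y0 rnorm_ge0.
  rewrite -(ler_pM2l ny) -expr2 -reinnerxx -{1}(LMK y) reinner_adjoint//.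
  rewrite (le_trans (reinner_le _ _))// mulrA ler_wpM2r ?rnorm_ge0//.
  by rewrite mulrC MN.
have A0 : 0 < A by case: fAB.
split; first by rewrite divr_gt0// exprn_gt0.
  (* Dividing both inequalities at [x0] by |x0|^2 orders the bounds. *)
  have [lo up] := image_frame_le x0 M0 Ly LN.
  by have := le_trans lo up; rewrite lee_fin ler_pM2r ?exprn_gt0.
by move=> x; exact: image_frame_le.
Qed.

End Frames.

Theorem proposition2p3 (R : realType) (k : scalar_kind) (H : hilbertType R k)
    (I : countType) (f : I -> H) (S : H -> H) (A B : R)
    (L : {linear H -> H}) :
  separable H ->
  frame_bounds f A B ->
  is_frame_operator f S ->
  bounded_op L ->
  (is_frame (L \o f) <-> set_surj [set: H] [set: H] L) /\
  (is_frame (L \o f) ->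
     is_frame_operator (L \o f) (L \o S \o adjoint L) /\
     ((exists x : H, x != 0) ->
        frame_bounds (L \o f)
          (A * opnorm (pseudo_inverse L) ^- 2) (B * opnorm L ^+ 2))).
Proof.
move=> _ fAB fS bL; split; first split.
- by move=> Lf y _; have [x <-] := image_frame_surjective fAB bL Lf y; exists x.
- move=> Lsurj; apply: (surjective_image_frame fAB bL) => y.
  by have [x _ <-] := Lsurj y Logic.I; exists x.
- move=> Lf; split; first exact: image_frame_operator.
  move=> Hn0; apply: image_frame_bounds => //.
  exact: image_frame_surjective fAB bL Lf.
Qed.
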